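(* The free energy $F_n(\beta,0)$ of the Sherrington--Kirkpatrick model at zero external field ($h=0$) and any inverse temperature $\beta$ has fluctuations of order at least $1$ (as $n\to\infty$).
   Context: Sherrington--Kirkpatrick (S-K) model: let $n$ be a positive integer and let $(g_{ij})_{1\le i<j\le n}$ be i.i.d. standard Gaussian random variables. The S-K model with $n$ spins at inverse temperature $\beta\ge 0$ and external field $h\in\mathbb{R}$ defines a random probability measure on $\{-1,1\}^n$, which puts mass proportional to $e^{\beta H_n(\sigma)}$ at each point $\sigma=(\sigma_1,\ldots,\sigma_n)\in\{-1,1\}^n$, where $$H_n(\sigma):=\frac{1}{\sqrt n}\sum_{1\le i<j\le n}g_{ij}\sigma_i\sigma_j+h\sum_{i=1}^n\sigma_i.$$ The free energy of the model is $$F_n(\beta,h):=\log\sum_{\sigma\in\{-1,1\}^n}e^{\beta H_n(\sigma)}.$$ Fluctuations: let $\{X_n\}_{n\ge1}$ be a sequence of random variables and $\{\delta_n\}_{n\ge1}$ a sequence of positive real numbers. We say that $X_n$ has fluctuations of order at least $\delta_n$ if there are positive constants $c_1$ and $c_2$ such that for all large $n$, and for all $-\infty<a\le b<\infty$ with $b-a\le c_1\delta_n$, $\mathbb{P}(a\le X_n\le b)\le 1-c_2$. ''Order at least $1$'' means $\delta_n=1$ for all $n$.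
   Formalization: The inverse temperature is taken to be strictly positive, since at inverse temperature 0 the free energy equals n log 2 deterministically and the claim fails. *)

(* Defs.v *)
From HB Require Import structures.
From mathcomp Require Import all_boot all_order all_algebra.
From mathcomp Require Import all_classical all_reals all_analysis.
From mathcomp Require Import measurable_realfun measurable_fun_approximation.

Set Implicit Arguments.
Unset Strict Implicit.
Unset Printing Implicit Defensive.

Import Order.TTheory GRing.Theory Num.Theory.
Import numFieldTopology.Exports numFieldNormedType.Exports.

Local Open Scope classical_set_scope.
Local Open Scope ring_scope.

(* Mutual independence of the subfamily [X i], [i \in D]: the product rule for
   every [J \subset D].  Values of [X] outside [D] are unconstrained. *)
Definition mutually_independent (d : measure_display) (T : measurableType d)
    (R : realType) (P : probability T R) (I : finType) (D : {set I})
    (X : I -> {RV P >-> R}) : Prop :=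
  forall (J : {set I}) (A : I -> set R), J \subset D ->
    (forall i, i \in J -> measurable (A i)) ->
    P (\bigcap_(i in [set` J]) (X i @^-1` A i)) =
      (\prod_(i in J) P (X i @^-1` A i))%E.

Definition standard_gaussian (d : measure_display) (T : measurableType d)
    (R : realType) (P : probability T R) (X : {RV P >-> R}) : Prop :=
  forall A : set R, measurable A -> distribution P X A = normal_prob 0 1 A.

(* Only the entries [g i j] with [i < j] matter; the others are junk. *)
Definition iid_gaussian_couplings (d : measure_display) (T : measurableType d)
    (R : realType) (P : probability T R) (n : nat)
    (g : 'I_n -> 'I_n -> {RV P >-> R}) : Prop :=
  (forall i j : 'I_n, (i < j)%N -> standard_gaussian (g i j)) /\
  mutually_independent
    [set p : 'I_n * 'I_n | (p.1 < p.2)%N]%SET (fun p => g p.1 p.2).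

(* A configuration of {-1,1}^n is coded by booleans: false is +1, true is -1. *)
Definition config (n : nat) : finType := {ffun 'I_n -> bool}.

Definition spin (R : realType) (n : nat) (s : config n) (i : 'I_n) : R :=
  (-1) ^+ s i.

Definition sk_hamiltonian (R : realType) (n : nat) (g : 'I_n -> 'I_n -> R)
    (h : R) (s : config n) : R :=
  (Num.sqrt n%:R)^-1 *
    (\sum_(i < n) \sum_(j < n | (i < j)%N) g i j * spin R s i * spin R s j)
  + h * \sum_(i < n) spin R s i.

Definition sk_free_energy (R : realType) (n : nat) (beta h : R)
    (g : 'I_n -> 'I_n -> R) : R :=
  ln (\sum_(s : config n) expR (beta * sk_hamiltonian g h s)).

Section free_energy_random_variable.
Context (d : measure_display) (T : measurableType d) (R : realType)
  (P : probability T R) (n : nat).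
Variables (beta h : R) (g : 'I_n -> 'I_n -> {RV P >-> R}).

Definition free_energy (x : T) : R :=
  sk_free_energy beta h (fun i j => g i j x).

Lemma measurable_free_energy : measurable_fun [set: T] free_energy.
Proof.
apply: (measurableT_comp (@measurable_ln R)).
apply: measurable_sum => s.
apply: (measurableT_comp (@measurable_expR R)).
apply: measurable_funM; first exact: measurable_cst.
apply: measurable_funD; last exact: measurable_cst.
apply: measurable_funM; first exact: measurable_cst.
apply: measurable_sum => i.
under eq_fun => x do rewrite -big_filter.
apply: measurable_sum => j.
apply: measurable_funM; last exact: measurable_cst.
by apply: measurable_funM; last exact: measurable_cst.
Qed.

HB.instance Definition _ :=
  isMeasurableFun.Build _ _ T R free_energy measurable_free_energy.

Definition free_energy_RV : {RV P >-> R} := free_energy.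

End free_energy_random_variable.

(* The [X n] need not be defined on a common probability space. *)
Definition fluctuations_at_least (R : realType) (d : nat -> measure_display)
    (T : forall n, measurableType (d n)) (P : forall n, probability (T n) R)
    (X : forall n, {RV P n >-> R}) (delta : nat -> R) : Prop :=
  exists c1 c2 : R, [/\ 0 < c1, 0 < c2 &
    \forall n \near \oo, forall a b : R,
      a <= b -> b - a <= c1 * delta n ->
      (P n [set x | (a <= X n x <= b)%R] <= (1 - c2)%:E)%E].

(* Main.v *)
Require Import Defs.
From HB Require Import structures.
From mathcomp Require Import all_boot all_order all_algebra.
From mathcomp Require Import all_classical all_reals all_analysis.
From mathcomp Require Import measurable_realfun measurable_fun_approximation.
From mathcomp Require Import ring lra.
Import Order.TTheory GRing.Theory Num.Theory.
Import numFieldTopology.Exports numFieldNormedType.Exports.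
Import HBNNSimple.

Set Implicit Arguments.
Unset Strict Implicit.
Unset Printing Implicit Defensive.

Local Open Scope classical_set_scope.
Local Open Scope ring_scope.

(** The argument is Chatterjee's coupling method.  Shrink the whole disorder by
    a factor [s] with [1 - s] of order [1/n].  There are about [n^2/2]
    independent Gaussian couplings, and at this scale the law of [s X] is
    comparable with the law of [X]: the likelihood ratio is a product whose
    second moment stays bounded, although the number of factors grows like
    [n^2].  Hence an event that has small probability under the law of [X] also
    has small probability under the law of [s X] ([scaled_gaussian_le]).

    On the other hand the shrinking moves the free energy by a constant.  With
    [h = 0] the free energy of [s X] at inverse temperature [b] is that of [X]
    at [s b], and it is convex in the inverse temperature.  Its value at inverse
    temperature zero is [n ln 2], so the shrinking lowers it by at least
    [1 - s] times the excess of the free energy over [n ln 2]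
    ([excess_scale_coupling]).  That excess is at least a constant times [n] on
    an event of probability at least [1/8].  By convexity it suffices to see
    this at a small inverse temperature [b0], where the second moment of the
    partition function is at most twice the square of its mean
    ([expectation_partition_sqr_le], [second_moment_method]).  The ratio of the
    two is at most the exponential moment of the squared overlap of two
    independent configurations, bounded in [sum_config_square].

    So on an event of probability [1/8] the free energies of [X] and [s X]
    differ by more than a constant, and cannot both lie in a shorter interval.
    If the free energy of [X] lay in such an interval with probability close
    to one, then so would that of [s X], a contradiction. *)

(** * Measures with a density *)

(** Both sides agree on indicators by the hypothesis on [nu]; linearity and
    monotone convergence along simple functions carry this over to [f]. *)
Lemma ge0_integral_density d (T : measurableType d) (R : realType)
    (mu nu : {measure set T -> \bar R}) (w : T -> R) :
  measurable_fun setT w -> (forall x, 0 <= w x) ->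
  (forall A, measurable A -> nu A = (\int[mu]_(x in A) (w x)%:E)%E) ->
  forall f : T -> R, measurable_fun setT f -> (forall x, 0 <= f x) ->
  (\int[nu]_x (f x)%:E = \int[mu]_x (f x * w x)%:E)%E.
Proof.
move=> mw w0 nuE f mf f0.
have mEf : measurable_fun setT (EFin \o f : T -> \bar R) by exact/measurable_EFinP.
pose f_ := nnsfun_approx measurableT mEf.
have cvgf x : (f_ n x)%:E @[n --> \oo] --> (f x)%:E.
  by apply: (@cvg_nnsfun_approx _ _ _ _ measurableT _ mEf) => // y _; rewrite lee_fin.
have ndf x : nondecreasing_seq (fun n => f_ n x).
  by move=> m n mn; exact/lefP/nd_nnsfun_approx.
transitivity (limn (fun n => \int[nu]_x (f_ n x)%:E)%E).
  rewrite -monotone_convergence//.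
  - by apply: eq_integral => y _; apply/esym/cvg_lim => //; exact: cvgf.
  - by move=> n; exact/measurable_EFinP/measurable_funP.
  - by move=> n y _; rewrite lee_fin.
  - by move=> y _ m n mn; rewrite lee_fin ndf.
transitivity (limn (fun n => \int[mu]_x (f_ n x * w x)%:E)%E); last first.
  rewrite -monotone_convergence//.
  - apply: eq_integral => y _; apply/cvg_lim => //.
    under eq_fun do rewrite EFinM; rewrite EFinM.
    by apply: cvgeZr => //; exact: cvgf.
  - by move=> n; apply/measurable_EFinP/measurable_funM.
  - by move=> n y _; rewrite lee_fin mulr_ge0.
  - by move=> y _ m n mn; rewrite lee_fin ler_wpM2r// ndf.
congr (limn _); apply/funext => n.
rewrite integralT_nnsfun sintegralE.
transitivity (\int[mu]_x (\sum_(k \in range (f_ n))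
    (k * \1_(f_ n @^-1` [set k]) x * w x)%:E))%E; last first.
  apply: eq_integral => x _.
  rewrite [in RHS]fimfunE mulr_fsuml -fsumEFin//.
rewrite ge0_integral_fsum//; last 2 first.
  - move=> k; apply/measurable_EFinP/measurable_funM => //.
    by apply: measurable_funM => //.
  - by move=> k x _; rewrite EFinM mule_ge0// ?nnfun_muleindic_ge0// lee_fin.
apply: eq_fsbigr => k _.
rewrite nuE; last exact: measurable_funPTI.
have [k0|k0] := leP 0 k; last first.
  rewrite preimage_nnfun0// integral_set0 mule0; apply/esym.
  by apply: integral0_eq => x _; rewrite indicE in_set0 mulr0 mul0r.
rewrite integral_mkcond -ge0_integralZl//.
- apply: eq_integral => x _; rewrite patchE indicE -mulrA EFinM.
  by case: ifPn => xA; rewrite ?mul1r ?mul0r.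
- apply/(measurable_restrictT _ _).1 => //.
  by apply: measurable_funTS; exact/measurable_EFinP.
- by move=> x _; rewrite patchE; case: ifPn => // _; rewrite lee_fin.
Qed.

Lemma density_measure d (T : measurableType d) (R : realType)
    (mu : {measure set T -> \bar R}) (w : T -> R) :
  measurable_fun setT w -> (forall x, 0 <= w x) ->
  exists nu : {measure set T -> \bar R},
    forall A, measurable A -> nu A = (\int[mu]_(x in A) (w x)%:E)%E.
Proof.
move=> mw w0; pose m A := (\int[mu]_(x in A) (w x)%:E)%E.
have m0 : m set0 = 0%E by exact: integral_set0.
have mge0 A : (0 <= m A)%E by apply: integral_ge0 => x _; rewrite lee_fin.
have madd : semi_sigma_additive m.
  move=> A mA tA mUA; rewrite /m ge0_integral_bigcup//.
  - apply: is_cvg_ereal_nneg_natsum_cond => n _ _; exact: mge0.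
  - by apply: measurable_funTS; exact/measurable_EFinP.
  - by move=> x _; rewrite lee_fin.
pose mm := isMeasure.Build _ _ _ m m0 mge0 madd.
pose nu : {measure set T -> \bar R} := HB.pack m mm.
by exists nu.
Qed.

Lemma ge0_integral_mull d (T : measurableType d) (R : realType)
    (mu : {measure set T -> \bar R}) (c : R) (f : T -> R) :
  0 <= c -> measurable_fun setT f -> (forall x, 0 <= f x) ->
  (\int[mu]_x (c * f x)%:E = c%:E * \int[mu]_x (f x)%:E)%E.
Proof.
move=> c0 mf f0; under eq_integral do rewrite EFinM.
rewrite ge0_integralZl//; first exact/measurable_EFinP.
by move=> x _; rewrite lee_fin.
Qed.

Lemma ge0_integral_addr d (T : measurableType d) (R : realType)
    (mu : {measure set T -> \bar R}) (f g : T -> R) :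
  measurable_fun setT f -> (forall x, 0 <= f x) ->
  measurable_fun setT g -> (forall x, 0 <= g x) ->
  (\int[mu]_x (f x + g x)%:E = \int[mu]_x (f x)%:E + \int[mu]_x (g x)%:E)%E.
Proof.
move=> mf f0 mg g0; under eq_integral do rewrite EFinD.
by rewrite ge0_integralD//; [move=> x _; rewrite lee_fin|exact/measurable_EFinP|
  move=> x _; rewrite lee_fin|exact/measurable_EFinP].
Qed.

Lemma ge0_le_integral_real d (T : measurableType d) (R : realType)
    (mu : {measure set T -> \bar R}) (f g : T -> R) :
  measurable_fun setT f -> (forall x, 0 <= f x) -> measurable_fun setT g ->
  (forall x, f x <= g x) ->
  (\int[mu]_x (f x)%:E <= \int[mu]_x (g x)%:E)%E.
Proof.
move=> mf f0 mg fg; apply: ge0_le_integral => //.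
- by move=> x _; rewrite lee_fin.
- exact/measurable_EFinP.
- exact/measurable_EFinP.
- by move=> x _; rewrite lee_fin.
Qed.

(** * Expectations of products of independent variables *)

Lemma measurable_comp_RV d (T : measurableType d) (R : realType)
    (P : probability T R) (X : {RV P >-> R}) (f : R -> R) :
  measurable_fun setT f -> measurable_fun setT (fun x => f (X x)).
Proof. by move=> mf; apply: (measurableT_comp mf). Qed.

Lemma measurable_prod_RV d (T : measurableType d) (R : realType)
    (P : probability T R) (I : finType) (A : pred I) (X : I -> {RV P >-> R})
    (f : I -> R -> R) : (forall i, measurable_fun setT (f i)) ->
  measurable_fun setT (fun x => \prod_(i | A i) f i (X i x)).
Proof.
move=> mf; under eq_fun do rewrite -big_filter.
by apply: measurable_prod => i _; exact: measurable_comp_RV.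
Qed.

Lemma preimage_RV_measurable d (T : measurableType d) (R : realType)
    (P : probability T R) (X : {RV P >-> R}) (A : set R) :
  measurable A -> measurable (X @^-1` A).
Proof. exact: measurable_funPTI. Qed.

(** Independence is a product rule for events; this restatement for
    indicators is the start of the induction in [expectation_prod]. *)
Lemma expectation_prod_indicators d (T : measurableType d) (R : realType)
    (P : probability T R) (I : finType) (D : {set I}) (X : I -> {RV P >-> R})
    (A : I -> set R) :
  mutually_independent D X -> (forall i, measurable (A i)) ->
  (\int[P]_w (\prod_(i in D) \1_(A i) (X i w))%:E =
   \prod_(i in D) \int[P]_w (\1_(A i) (X i w))%:E)%E.
Proof.
move=> indep mA.
have mX i : measurable (X i @^-1` A i) by exact: preimage_RV_measurable.
transitivity (P (\bigcap_(i in [set` D]) (X i @^-1` A i))).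
  rewrite -[in RHS](setIT (\bigcap_(i in _) _)) -integral_indic//; last first.
    by apply: fin_bigcap_measurable => //; exact: finite_finset.
  apply: eq_integral => w _; congr EFin.
  have [wA|wA] := pselect ((\bigcap_(i in [set` D]) (X i @^-1` A i)) w).
    rewrite indicE mem_set// big1// => i iD.
    by rewrite indicE mem_set//; exact: wA.
  rewrite indicE memNset//.
  have [i iD iA] : exists2 i, i \in D & ~ A i (X i w).
    apply: contrapT => nA; apply: wA => i iD; apply: contrapT => ?.
    by apply: nA; exists i.
  by rewrite (bigD1 i)//= indicE memNset// mul0r.
rewrite indep//; apply: eq_bigr => i _.
by rewrite -[in LHS](setIT (_ @^-1` _)) -integral_indic.
Qed.

(** Indicators are replaced by general functions one index at a time: [E] is
    the set of indices [i] where [g i] need not be an indicator.  To free the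
    index [i0], let [W] be the product of the other factors.  By induction
    the measure [A |-> E[W; X i0 \in A]] is [E[W]] times the law of [X i0], so
    integrating [g i0] against the two measures gives the factorization. *)
Lemma expectation_prod d (T : measurableType d) (R : realType)
    (P : probability T R) (I : finType) (D : {set I}) (X : I -> {RV P >-> R})
    (f : I -> R -> R) :
  mutually_independent D X ->
  (forall i, measurable_fun setT (f i)) -> (forall i x, 0 <= f i x) ->
  (forall i, i \in D -> (\int[P]_w (f i (X i w))%:E < +oo)%E) ->
  (\int[P]_w (\prod_(i in D) f i (X i w))%:E =
   \prod_(i in D) \int[P]_w (f i (X i w))%:E)%E.
Proof.
move=> indep.
suff H (E : {set I}) : forall g : I -> R -> R,
    (forall i, measurable_fun setT (g i)) -> (forall i x, 0 <= g i x) ->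
    (forall i, i \in D -> (\int[P]_w (g i (X i w))%:E < +oo)%E) ->
    (forall i, i \notin E -> exists2 A, measurable A & g i = \1_A) ->
  (\int[P]_w (\prod_(i in D) g i (X i w))%:E =
   \prod_(i in D) \int[P]_w (g i (X i w))%:E)%E.
  move=> mf f0 fi; apply: (H [set: I]%SET) => // i; by rewrite inE.
have [n] := ubnP #|E|; elim: n => // n IH in E *; rewrite ltnS => En g mg g0 gi gE.
have [E0|[i0 i0E]] := set_0Vmem E.
  have /choice[A HA] : forall i, exists A : set R, measurable A /\ g i = \1_A.
    by move=> i; have [|A mA gA] := gE i; rewrite ?E0 ?inE//; exists A.
  have -> : g = (fun i => \1_(A i)) by apply/funext => i; exact: (HA i).2.
  by apply: expectation_prod_indicators => // i; exact: (HA i).1.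
have {}IH (A : set R) : measurable A ->
    let g' i := if i == i0 then \1_A else g i in
    (\int[P]_w (\prod_(i in D) g' i (X i w))%:E =
     \prod_(i in D) \int[P]_w (g' i (X i w))%:E)%E.
  move=> mA; apply: (IH (E :\ i0)).
  - by rewrite (leq_trans _ En)// (cardsD1 i0 E) i0E.
  - by move=> i; case: ifP.
  - by move=> i x; case: ifP.
  - move=> i iD; case: ifP => _; last exact: gi.
    have mXA := preimage_RV_measurable (X i) mA.
    rewrite (_ : (fun _ => _) = EFin \o \1_(X i @^-1` A)) ?integral_indic// setIT.
    by rewrite (le_lt_trans (probability_le1 P mXA))// ltry.
  - move=> i; rewrite !inE; case: ifPn => [/eqP -> _|ii0 /= iE]; first by exists A.
    exact: gE.
have [i0D|i0D] := boolP (i0 \in D); last first.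
  have := IH _ measurableT => /=.
  have ne i : i \in D -> (i == i0) = false.
    by move=> iD; apply: contraNF i0D => /eqP <-.
  under eq_integral do under eq_bigr do rewrite ne//.
  by under eq_bigr do rewrite ne//.
pose W w := \prod_(i in D | i != i0) g i (X i w).
pose c := (\prod_(i in D | i != i0) \int[P]_w (g i (X i w))%:E)%E.
have c0 : (0 <= c)%E.
  by apply: prode_ge0 => i _; apply: integral_ge0 => w _; rewrite lee_fin.
have cE : c = (fine c)%:E.
  rewrite fineK//; rewrite /c; apply/prode_fin_num => i /andP[iD _].
  by rewrite ge0_fin_numE ?gi// integral_ge0// => w _; rewrite lee_fin.
have mW : measurable_fun setT W by exact: measurable_prod_RV.
have W0 w : 0 <= W w by exact: prodr_ge0.
have [nu nuE] := density_measure P mW W0.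
have IHA A : measurable A ->
    pushforward nu (X i0) A = mscale (NngNum (fine_ge0 c0)) (distribution P (X i0)) A.
  move=> mA; have /= := IH A mA; rewrite (bigD1 i0)//=.
  rewrite (_ : (\prod_(i in D | i != i0) _)%E = c); last first.
    by apply: eq_bigr => i /andP[_ /negbTE ->].
  rewrite eqxx.
  rewrite /pushforward nuE//; last exact: preimage_RV_measurable.
  move=> H; rewrite integral_mkcond.
  transitivity (\int[P]_w (\prod_(i in D)
    (if i == i0 then \1_A else g i) (X i w))%:E)%E.
    apply: eq_integral => w _; rewrite patchE (bigD1 i0)//= eqxx indicE.
    rewrite (eq_bigr (fun i => g i (X i w))); last by move=> i /andP[_ /negbTE ->].
    have [wA|wA] := boolP (X i0 w \in A).
      by rewrite mem_set ?mul1r//; exact: set_mem.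
    by rewrite memNset ?mul0r// => /mem_set; exact/negP.
  rewrite H /mscale/= -cE muleC; congr (_ * _)%E.
  rewrite /distribution /pushforward.
  rewrite -(setIT (_ @^-1` _)) -integral_indic//; exact: preimage_RV_measurable.
rewrite (bigD1 i0)//= -/c cE muleC.
have mgX : measurable_fun setT (fun w => g i0 (X i0 w)) by exact: measurable_comp_RV.
transitivity (\int[P]_w (g i0 (X i0 w) * W w)%:E)%E.
  by apply: eq_integral => w _; rewrite (bigD1 i0).
rewrite -(ge0_integral_density mW W0 nuE)//.
have mg0 : measurable_fun setT (fun x => (g i0 x)%:E) by exact/measurable_EFinP.
transitivity (\int[pushforward nu (X i0)]_x (g i0 x)%:E)%E.
  by rewrite ge0_integral_pushforward// => x _; rewrite lee_fin.
rewrite (eq_measure_integral _ (fun A mA _ => IHA A mA)).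
rewrite ge0_integral_mscale//; last by move=> x _; rewrite lee_fin.
congr (_ * _)%E.
by rewrite ge0_integral_distribution// => y; rewrite lee_fin.
exact: measurable_funPT.
Qed.

(** * Gaussian integrals and dilations *)

(** The law of [X] and [normal_prob] live on two copies of the Borel space of
    [R] that differ by their display; going through the pushforward to the
    second copy connects them. *)
Lemma ge0_integral_standard_gaussian d (T : measurableType d) (R : realType)
    (P : probability T R) (X : {RV P >-> R}) (f : R -> R) :
  standard_gaussian X -> measurable_fun setT f -> (forall x, 0 <= f x) ->
  (\int[P]_w (f (X w))%:E = \int[normal_prob 0 1]_x (f x)%:E)%E.
Proof.
move=> gX mf f0.
have mEf : measurable_fun setT (fun x => (f x)%:E) by exact/measurable_EFinP.
pose Y : T -> measurableTypeR R := X.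
have mY : measurable_fun setT Y by exact: (@measurable_funPT _ _ _ _ X).
transitivity (\int[pushforward P Y]_x (f x)%:E)%E.
  by rewrite (ge0_integral_pushforward mY _ measurableT mEf) ?preimage_setT// => x _; rewrite lee_fin.
rewrite (eq_measure_integral (normal_prob 0 1))//.
by move=> A mA _; exact: gX.
Qed.

Lemma ge0_integral_normal_prob (R : realType) (m s : R) (f : R -> R) :
  measurable_fun setT f -> (forall x, 0 <= f x) ->
  (\int[normal_prob m s]_x (f x)%:E =
   \int[lebesgue_measure]_x (f x * normal_pdf m s x)%:E)%E.
Proof.
move=> mf f0.
apply: (@ge0_integral_density _ (measurableTypeR R) R lebesgue_measure
  (normal_prob m s) (normal_pdf m s)) => //.
- exact: measurable_normal_pdf.
- exact: normal_pdf_ge0.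
Qed.

(** The likelihood ratio between the centred normal laws of standard
    deviations [s] and [1]. *)
Definition gaussian_ratio (R : realType) (s x : R) : R :=
  s^-1 * expR ((1 - s ^- 2) / 2 * x ^+ 2).

Lemma measurable_gaussian_ratio (R : realType) (s : R) :
  measurable_fun setT (gaussian_ratio s).
Proof.
apply: measurable_funM => //; apply: measurableT_comp => //.
by apply: measurable_funM => //; exact: measurable_funX.
Qed.

Lemma gaussian_ratio_ge0 (R : realType) (s x : R) : 0 < s -> 0 <= gaussian_ratio s x.
Proof. by move=> s0; rewrite mulr_ge0 ?expR_ge0// invr_ge0 ltW. Qed.

Lemma gaussian_ratioE (R : realType) (s x : R) : 0 < s ->
  gaussian_ratio s x * normal_pdf 0 1 x = normal_pdf 0 s x.
Proof.
move=> s0; rewrite !normal_pdfE ?oner_eq0 ?gt_eqF// /normal_peak /normal_fun.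
rewrite expr1n mul1r -(mulrnAr (s ^+ 2)) sqrtrM ?sqr_ge0// sqrtr_sqr gtr0_norm//.
rewrite invfM /gaussian_ratio mulrACA -expRD; congr (_ * expR _).
by rewrite !subr0 -mulr_natr; field; rewrite gt_eqF.
Qed.

Lemma integral_gaussian_ratio (R : realType) (s : R) : 0 < s ->
  (\int[normal_prob 0 1]_x (gaussian_ratio s x)%:E = 1)%E.
Proof.
move=> s0; rewrite ge0_integral_normal_prob; last 2 first.
- exact: measurable_gaussian_ratio.
- by move=> x; exact: gaussian_ratio_ge0.
under eq_integral do rewrite gaussian_ratioE//.
exact: integral_normal_pdf.
Qed.

(** Completing the square turns the integrand into a multiple of the normal
    density with mean [s]. *)
Lemma integral_gaussian_expR (R : realType) (s : R) :
  (\int[normal_prob 0 1]_x (expR (s * x))%:E = (expR (s ^+ 2 / 2))%:E)%E.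
Proof.
rewrite ge0_integral_normal_prob; last 2 first.
- by apply: measurableT_comp => //; exact: measurable_funM.
- by move=> x; exact: expR_ge0.
transitivity (\int[lebesgue_measure]_x
    (expR (s ^+ 2 / 2) * normal_pdf s 1 x)%:E)%E.
  apply: eq_integral => x _; congr EFin.
  rewrite !normal_pdfE ?oner_eq0// mulrCA [RHS]mulrCA; congr (_ * _).
  rewrite /normal_fun -!expRD; congr expR.
  by rewrite expr1n subr0; field.
rewrite ge0_integral_mull ?expR_ge0//; last 2 first.
- exact: measurable_normal_pdf.
- exact: normal_pdf_ge0.
by rewrite integral_normal_pdf mule1.
Qed.

(** Up to the factor [s], the integrand is a likelihood ratio, hence has a
    known integral. *)
Lemma integral_gaussian_square (R : realType) (s a : R) : 0 < s ->
  a = (1 - s ^- 2) / 2 ->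
  (\int[normal_prob 0 1]_x (expR (a * x ^+ 2))%:E = s%:E)%E.
Proof.
move=> s0 ->.
transitivity (\int[normal_prob 0 1]_x (s * gaussian_ratio s x)%:E)%E.
  apply: eq_integral => x _; congr EFin.
  by rewrite /gaussian_ratio mulVKf ?gt_eqF.
rewrite ge0_integral_mull ?ltW//; last 2 first.
- exact: measurable_gaussian_ratio.
- by move=> x; exact: gaussian_ratio_ge0.
by rewrite integral_gaussian_ratio// mule1.
Qed.

(** The square of a likelihood ratio is, up to a factor, again a likelihood
    ratio, for the standard deviation [t]. *)
Lemma integral_gaussian_ratio_sqr (R : realType) (s t : R) : 0 < s -> 0 < t ->
  t ^- 2 = 2 * s ^- 2 - 1 ->
  (\int[normal_prob 0 1]_x (gaussian_ratio s x ^+ 2)%:E = (s ^- 2 * t)%:E)%E.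
Proof.
move=> s0 t0 st.
transitivity (\int[normal_prob 0 1]_x
    (s ^- 2 * expR ((1 - s ^- 2) * x ^+ 2))%:E)%E.
  apply: eq_integral => x _; congr EFin.
  rewrite /gaussian_ratio exprMn exprVn; congr (_ * _).
  by rewrite expr2 -expRD; congr expR; field; rewrite gt_eqF.
have mexp : measurable_fun setT (fun x : R => expR ((1 - s ^- 2) * x ^+ 2)).
  apply: measurableT_comp => //.
  by apply: measurable_funM => //; exact: measurable_funX.
rewrite ge0_integral_mull ?invr_ge0 ?sqr_ge0//.
rewrite (@integral_gaussian_square _ t)//.
by rewrite st; field; rewrite gt_eqF.
Qed.

(** Lebesgue measure is determined by its values on intervals, where the
    scaling rule is a computation. *)
Lemma lebesgue_measure_mulr (R : realType) (s : R) (A : set R) : 0 < s ->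
  measurable A ->
  (s%:E * lebesgue_measure ( *%R s @^-1` A) = lebesgue_measure A)%E.
Proof.
move=> s0 mA.
pose sc : measurableTypeR R -> measurableTypeR R := *%R s.
have msc : measurable_fun setT sc by exact: (mulrl_measurable s).
pose pf : {measure set (measurableTypeR R) -> \bar R} :=
  measure_function_pushforward__canonical__measure_function_Measure lebesgue_measure msc.
transitivity (mscale (NngNum (ltW s0)) pf A) => //.
apply/esym/lebesgue_measure_unique => //= _ [[a b]] _ <-.
rewrite /mscale /= /pushforward.
rewrite (_ : _ @^-1` _ = `](a / s), (b / s)]%classic); last first.
  apply/seteqP; split => x /=; rewrite !in_itv/= ltr_pdivrMr// ler_pdivlMr//;
  by rewrite mulrC.
rewrite !lebesgue_measure_itv/= !lte_fin ltr_pM2r ?invr_gt0//.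
case: ifPn => _; last by rewrite mule0.
by rewrite -!EFinB -EFinM -mulrBl mulrCA divff ?mulr1// gt_eqF.
Qed.

Lemma normal_pdf_scale (R : realType) (s x : R) : 0 < s ->
  s * normal_pdf 0 s (s * x) = normal_pdf 0 1 x.
Proof.
move=> s0; rewrite -gaussian_ratioE// /gaussian_ratio.
rewrite -!mulrA mulVKf ?gt_eqF// !normal_pdfE ?oner_eq0//.
rewrite mulrCA; congr (_ * _); rewrite /normal_fun -expRD; congr expR.
by rewrite !subr0 expr1n; field; rewrite gt_eqF.
Qed.

(** The law of [s X] for a standard normal [X] has density [gaussian_ratio s]
    with respect to the law of [X]. *)
Lemma normal_prob_scale (R : realType) (s : R) (A : set R) : 0 < s -> measurable A ->
  (normal_prob 0 1 ( *%R s @^-1` A) =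
   \int[normal_prob 0 1]_x (\1_A x * gaussian_ratio s x)%:E)%E.
Proof.
move=> s0 mA; rewrite ge0_integral_normal_prob; last 2 first.
- apply: measurable_funM; first exact: measurable_indic.
  exact: measurable_gaussian_ratio.
- by move=> x; rewrite mulr_ge0// gaussian_ratio_ge0.
under eq_integral do rewrite -mulrA gaussian_ratioE//.
pose f (x : measurableTypeR R) := (\1_A x * normal_pdf 0 s x)%:E.
have mf : measurable_fun setT f.
  apply/measurable_EFinP.
  have m1 : measurable_fun setT (fun x : R => \1_A x * normal_pdf 0 s x).
    apply: measurable_funM; first exact: measurable_indic.
    exact: measurable_normal_pdf.
  exact: m1.
have f0 x : (0 <= f x)%E by rewrite lee_fin mulr_ge0// normal_pdf_ge0.
pose sc : measurableTypeR R -> measurableTypeR R := *%R s.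
have msc : measurable_fun setT sc by exact: (mulrl_measurable s).
pose pf : {measure set (measurableTypeR R) -> \bar R} :=
  measure_function_pushforward__canonical__measure_function_Measure lebesgue_measure msc.
transitivity (\int[mscale (NngNum (ltW s0)) pf]_x f x)%E.
  rewrite ge0_integral_mscale// ge0_integral_pushforward// preimage_setT.
  rewrite -ge0_integralZl//=; [|exact: (measurableT_comp mf msc)|by rewrite lee_fin ltW].
  rewrite /normal_prob integral_mkcond; apply: eq_integral => x _.
  rewrite patchE /f/= -EFinM indicE.
  case: ifPn => xA.
    rewrite mem_set; last by move: xA; rewrite inE.
    rewrite mul1r; congr EFin.
    by rewrite normal_pdf_scale.
  rewrite memNset ?mul0r ?mulr0// => /mem_set.
  exact/negP.
apply: eq_measure_integral => B mB _.
by apply: lebesgue_measure_mulr.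
Qed.

(** * Change of measure for a dilated Gaussian disorder *)

(** Only the coordinates in [D] are constrained: the others carry no
    information about the disorder. *)
Definition cylinders (R : realType) (I : finType) (D : {set I}) : set (set (I -> R)) :=
  [set C | exists2 A : I -> set R, (forall i, measurable (A i)) &
           C = [set y | forall i, i \in D -> A i (y i)]].

Definition disorder (R : realType) (I : finType) (D : {set I}) :=
  g_sigma_algebraType (@cylinders R I D).

HB.instance Definition _ (R : realType) (I : finType) (D : {set I}) :=
  Measurable.on (@disorder R I D).

Lemma setI_closed_cylinders (R : realType) (I : finType) (D : {set I}) :
  setI_closed (@cylinders R I D).
Proof.
move=> _ _ [A mA ->] [B mB ->]; exists (fun i => A i `&` B i).
  by move=> i; exact: measurableI.
apply/seteqP; split => y /=; first by move=> [Ay By] i iD; split; [exact: Ay|exact: By].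
by move=> ABy; split => i iD; have [] := ABy i iD.
Qed.

Lemma measurable_coordinate (R : realType) (I : finType) (D : {set I}) (i : I) :
  i \in D -> measurable_fun setT (fun y : disorder R D => y i).
Proof.
move=> iD _ A mA; rewrite setTI; apply: sub_sigma_algebra.
exists (fun j => if j == i then A else setT); first by move=> j; case: ifP.
apply/seteqP; split => y /=; first by move=> Ay j jD; case: eqP => // ->.
by move=> /(_ i iD); rewrite eqxx.
Qed.

Lemma measurable_fun_disorder d (T : measurableType d) (R : realType) (I : finType)
    (D : {set I}) (Y : I -> T -> R) : (forall i, measurable_fun setT (Y i)) ->
  measurable_fun setT ((fun w => Y^~ w) : T -> disorder R D).
Proof.
move=> mY; apply: (@measurability _ _ T (disorder R D) _ _ (@cylinders R I D)) => //.
move=> _ [_ [A mA ->] <-]; rewrite setTI.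
rewrite (_ : _ @^-1` _ = \bigcap_(i in [set` D]) (Y i @^-1` A i)) //.
apply: fin_bigcap_measurable; first exact: finite_finset.
by move=> i _; rewrite -[X in measurable X]setTI; exact: mY.
Qed.

Definition disorder_ratio (R : realType) (I : finType) (D : {set I}) (s : R)
  (y : I -> R) : R := \prod_(i in D) gaussian_ratio s (y i).

Lemma disorder_ratio_ge0 (R : realType) (I : finType) (D : {set I}) (s : R)
  (y : I -> R) : 0 < s -> 0 <= disorder_ratio D s y.
Proof. by move=> s0; apply: prodr_ge0 => i _; exact: gaussian_ratio_ge0. Qed.

(** Both sides are finite measures in [B].  They agree on cylinders, where
    independence factors them into one-dimensional terms treated by
    [normal_prob_scale], and cylinders are stable under intersection and
    generate the sigma-algebra. *)
Lemma scaled_gaussian_law d (T : measurableType d) (R : realType)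
    (P : probability T R) (I : finType) (D : {set I}) (X : I -> {RV P >-> R})
    (s : R) (B : set (disorder R D)) :
  mutually_independent D X -> (forall i, i \in D -> standard_gaussian (X i)) ->
  0 < s -> measurable B ->
  (P [set w | B (fun i => s * X i w)%R] =
   \int[P]_w (\1_B (fun i => X i w) * disorder_ratio D s (fun i => X i w))%:E)%E.
Proof.
move=> indep gX s0 mB.
pose rho w := disorder_ratio D s (fun i => X i w).
have rho0 w : 0 <= rho w by exact: disorder_ratio_ge0.
have mrho : measurable_fun setT rho.
  apply: (@measurable_prod_RV _ _ _ _ _ (mem D) _ (fun=> gaussian_ratio s)) => i.
  exact: measurable_gaussian_ratio.
have [nu nuE] := density_measure P mrho rho0.
pose Y w : disorder R D := fun i => X i w.
pose sY w : disorder R D := fun i => s * X i w.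
have mY : measurable_fun setT Y.
  by apply: (@measurable_fun_disorder _ _ _ _ D (fun i => X i)) => i; exact: measurable_funPT.
have msY : measurable_fun setT sY.
  apply: (@measurable_fun_disorder _ _ _ _ D (fun i w => s * X i w)) => i.
  exact: measurable_funM.
pose m1 : {measure set (disorder R D) -> \bar R} :=
  measure_function_pushforward__canonical__measure_function_Measure P msY.
pose m2 : {measure set (disorder R D) -> \bar R} :=
  measure_function_pushforward__canonical__measure_function_Measure nu mY.
have nu_ind (A : set (disorder R D)) : measurable A ->
    m2 A = (\int[P]_w (\1_A (fun i => X i w) * rho w)%:E)%E.
  move=> mA; rewrite /m2/= /pushforward nuE; last first.
    by rewrite -[X in measurable X]setTI; exact: (mY measurableT A mA).
  rewrite integral_mkcond; apply: eq_integral => w _.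
  rewrite patchE indicE; case: ifPn => wA.
    by rewrite mem_set ?mul1r//; move: wA; rewrite inE.
  by rewrite memNset ?mul0r// => /mem_set; exact/negP.
rewrite -/rho -nu_ind//.
apply: (@measure_unique _ _ (disorder R D) (@cylinders R I D) (fun=> setT) _ _ _ _ m1 m2) => //.
- exact: setI_closed_cylinders.
- by move=> _; exists (fun=> setT) => //; apply/seteqP; split.
- by rewrite bigcup_const.
- move=> _ [A mA ->].
  have msA i : measurable ( *%R s @^-1` A i).
    by rewrite -[X in measurable X]setTI; exact: (mulrl_measurable s).
  have mAr i : measurable_fun setT (fun x => \1_(A i) x * gaussian_ratio s x).
    by apply: measurable_funM; [exact: measurable_indic|exact: measurable_gaussian_ratio].
  have Ar0 i x : 0 <= \1_(A i) x * gaussian_ratio s x.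
    by rewrite mulr_ge0// gaussian_ratio_ge0.
  have m1i i : i \in D -> P (X i @^-1` ( *%R s @^-1` A i)) =
      (\int[P]_w (\1_(A i) (X i w) * gaussian_ratio s (X i w))%:E)%E.
    move=> iD; rewrite (ge0_integral_standard_gaussian (gX i iD) (mAr i) (Ar0 i)).
    rewrite -normal_prob_scale//; exact: gX.
  rewrite nu_ind; last by apply: sub_sigma_algebra; exists A.
  transitivity (\prod_(i in D)
      \int[P]_w (\1_(A i) (X i w) * gaussian_ratio s (X i w))%:E)%E.
    rewrite -(eq_bigr _ m1i) -indep//; congr (P _).
  rewrite -(expectation_prod indep mAr Ar0).
    apply: eq_integral => w _; congr EFin; rewrite big_split/=; congr (_ * _).
    have [wA|wA] := pselect (forall i, i \in D -> A i (X i w)).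
      rewrite indicE mem_set; last exact: wA.
      rewrite big1// => i iD; rewrite indicE mem_set//; exact: wA.
    rewrite indicE memNset//; apply/eqP; rewrite prodf_seq_eq0; apply: contrapT => nA.
    apply: wA => i iD; apply: contrapT => Ai; apply: nA; apply/hasP.
    by exists i; [exact: mem_index_enum|rewrite iD indicE memNset// eqxx].
  move=> i iD; rewrite -m1i//.
  by rewrite (le_lt_trans (probability_le1 P (preimage_RV_measurable _ (msA i))))// ltry.
- by move=> _; rewrite /m1/= /pushforward preimage_setT probability_setT ltry.
Qed.

(** The density [rho] of the dilated disorder satisfies
    [rho <= K + rho^2 / (4 K)], so an event costs at most [K] times its
    probability plus a multiple of the second moment of [rho].  Letting [K] be
    large makes the second term small uniformly in the dimension, as long as
    that second moment stays bounded. *)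
Lemma scaled_gaussian_le d (T : measurableType d) (R : realType)
    (P : probability T R) (I : finType) (D : {set I}) (X : I -> {RV P >-> R})
    (s t K : R) (B : set (disorder R D)) :
  mutually_independent D X -> (forall i, i \in D -> standard_gaussian (X i)) ->
  0 < s -> 0 < t -> t ^- 2 = 2 * s ^- 2 - 1 -> 0 < K -> measurable B ->
  (P [set w | B (fun i => s * X i w)%R] <=
   K%:E * P [set w | B (fun i => X i w)]
   + ((4 * K)^-1 * (s ^- 2 * t) ^+ #|D|)%:E)%E.
Proof.
move=> indep gX s0 t0 st K0 mB; rewrite scaled_gaussian_law//.
pose rho w := disorder_ratio D s (fun i => X i w).
have rho0 w : 0 <= rho w by exact: disorder_ratio_ge0.
have mrho : measurable_fun setT rho.
  apply: (@measurable_prod_RV _ _ _ _ _ (mem D) _ (fun=> gaussian_ratio s)) => i.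
  exact: measurable_gaussian_ratio.
pose Y w : disorder R D := fun i => X i w.
have mY : measurable_fun setT Y.
  by apply: (@measurable_fun_disorder _ _ _ _ D (fun i => X i)) => i; exact: measurable_funPT.
have mYB : measurable (Y @^-1` B).
  by rewrite -[X in measurable X]setTI; exact: (mY measurableT B mB).
have m1B : measurable_fun setT (fun w => \1_B (Y w) : R).
  exact: (measurable_indic mYB).
have rho2 : (\int[P]_w (rho w ^+ 2)%:E = ((s ^- 2 * t) ^+ #|D|)%:E)%E.
  have mr : forall i : I, measurable_fun setT (fun x : R => gaussian_ratio s x ^+ 2).
    by move=> _; apply: measurable_funX; exact: measurable_gaussian_ratio.
  have r2 i : i \in D ->
      (\int[P]_w (gaussian_ratio s (X i w) ^+ 2)%:E = (s ^- 2 * t)%:E)%E.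
    move=> iD; rewrite (ge0_integral_standard_gaussian (gX i iD) (mr i)); last first.
      by move=> x; exact: sqr_ge0.
    exact: integral_gaussian_ratio_sqr.
  under eq_integral do rewrite /rho /disorder_ratio -prodrXl.
  rewrite (expectation_prod (f := fun _ x => gaussian_ratio s x ^+ 2) indep mr).
  - by rewrite (eq_bigr _ r2) prodEFin prodr_const.
  - by move=> _ x; exact: sqr_ge0.
  - by move=> i iD; rewrite r2// ltry.
rewrite EFinM -rho2 -ge0_integral_mull; last 3 first.
- by rewrite invr_ge0 mulr_ge0// ltW.
- exact: measurable_funX.
- by move=> x; exact: sqr_ge0.
rewrite -[P _](_ : (\int[P]_w (\1_B (Y w))%:E)%E = _); last first.
  by rewrite (_ : (fun _ => _) = EFin \o \1_(Y @^-1` B)) ?integral_indic ?setIT.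
rewrite -ge0_integral_mull//; last exact: ltW.
have K40 : 0 <= (4 * K)^-1 by rewrite invr_ge0 mulr_ge0// ltW.
rewrite -ge0_integralD//; last 4 first.
- by move=> w _; rewrite lee_fin mulr_ge0// ltW.
- by apply/measurable_EFinP; exact: measurable_funM.
- by move=> w _; rewrite lee_fin mulr_ge0// sqr_ge0.
- by apply/measurable_EFinP; apply: measurable_funM => //; exact: measurable_funX.
apply: ge0_le_integral => //.
- by move=> w _; rewrite lee_fin; apply: mulr_ge0 => //; exact: rho0.
- by apply/measurable_EFinP; exact: (measurable_funM m1B mrho).
- apply: emeasurable_funD; apply/measurable_EFinP; first exact: measurable_funM.
  by apply: measurable_funM => //; exact: measurable_funX.
move=> w _; rewrite -EFinD lee_fin -/(Y w) -/(rho w).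
rewrite indicE; case: (_ \in _); rewrite /= ?mul1r ?mulr1 ?mul0r ?mulr0 ?add0r; last first.
  by rewrite mulr_ge0// sqr_ge0.
(* The slack in [rho <= K + rho^2 / (4 K)] is a square. *)
rewrite -subr_ge0 (_ : _ - _ = (4 * K)^-1 * (rho w - 2 * K) ^+ 2).
  by rewrite mulr_ge0// sqr_ge0.
by field; rewrite gt_eqF.
Qed.

(** * Overlaps of configurations and sums over pairs *)

(** A crude sub-Gaussian bound on the hyperbolic cosine.  For [u >= 1/2] it
    holds because [u <= 2 u^2]; below, [expR v <= (1 - v)^-1] bounds the sum by
    [2 / (1 - u^2)]. *)
Lemma expR_sum_le_square (R : realType) (u : R) :
  expR u + expR (- u) <= 2 * expR (2 * u ^+ 2).
Proof.
wlog u0 : u / 0 <= u => [H|].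
  have [|/ltW u0] := leP 0 u; first exact: H.
  have := H (- u); rewrite oppr_ge0 u0 opprK sqrrN => /(_ isT).
  by rewrite addrC.
have [u2|u2] := leP (1 / 2) u.
  have h1 : expR u <= expR (2 * u ^+ 2) by rewrite ler_expR; nra.
  have h2 : expR (- u) <= expR (2 * u ^+ 2) by rewrite ler_expR; nra.
  lra.
have e1 : expR u <= (1 - u)^-1.
  rewrite -[u in leLHS]opprK expRN lef_pV2 ?posrE ?expR_gt0//; last lra.
  exact: expR_ge1Dx.
have e2 : expR (- u) <= (1 + u)^-1.
  rewrite expRN lef_pV2 ?posrE ?expR_gt0//; last lra.
  exact: expR_ge1Dx.
have e3 := expR_ge1Dx (2 * u ^+ 2).
(* [1 / (1 - v) <= 1 + 2 v] for [v = u^2 <= 1/4]. *)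
have e4 : (1 - u)^-1 + (1 + u)^-1 <= 2 * (1 + 2 * u ^+ 2).
  rewrite (_ : _ + _ = 2 / (1 - u ^+ 2)); last first.
    field; apply/and3P; split; [nra|lra|lra].
  rewrite ler_pdivrMr; last nra.
  have : 0 <= u ^+ 2 by exact: sqr_ge0.
  have : u ^+ 2 <= 1 / 4 by nra.
  by nra.
lra.
Qed.

Lemma sum_config_expR (R : realType) (n : nat) (c : 'I_n -> R) :
  \sum_(s : config n) expR (\sum_i c i * spin R s i) =
  \prod_i (expR (c i) + expR (- c i)).
Proof.
rewrite (eq_bigr (fun s : config n => \prod_i expR (c i * spin R s i))); last first.
  by move=> s _; rewrite expR_sum.
rewrite -(bigA_distr_bigA (fun i (b : bool) => expR (c i * (-1) ^+ b))).
apply: eq_bigr => i _; rewrite big_bool/= addrC.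
by rewrite expr0 expr1 mulr1 mulrN1.
Qed.

Lemma card_config (n : nat) : #|config n| = (2 ^ n)%N.
Proof. by rewrite card_ffun card_bool card_ord. Qed.

(** Gaussian linearization: [expR (th r^2)] is the average of [expR (u r z)]
    over a standard normal [z], where [u^2 = 2 th].  For fixed [z] the sum over
    configurations factors over the sites, and the bound on each factor leaves
    [expR (4 th n z^2)], whose exponent is at most [3/8 z^2]. *)
Lemma sum_config_square (R : realType) (n : nat) (th : R) (x : 'I_n -> R) :
  (forall i, x i ^+ 2 = 1) -> 0 <= th -> th * n%:R <= 3 / 32 ->
  \sum_(s : config n) expR (th * (\sum_i x i * spin R s i) ^+ 2) <= 2 * 2 ^+ n.
Proof.
move=> x1 th0 thn.
pose u := Num.sqrt (2 * th).
have u2 : u ^+ 2 = 2 * th by rewrite sqr_sqrtr// mulr_ge0.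
pose r s := \sum_i x i * spin R s i.
have mexp (a : R) : measurable_fun setT (fun z : R => expR (a * z)).
  by apply: measurableT_comp => //; exact: measurable_funM.
have mexp2 : measurable_fun setT (fun z : R => expR (3 / 8 * z ^+ 2)).
  apply: measurableT_comp => //.
  by apply: measurable_funM => //; exact: measurable_funX.
rewrite -lee_fin -sumEFin.
rewrite (eq_bigr (fun s => \int[normal_prob 0 1]_z (expR (u * r s * z))%:E)%E); last first.
  move=> s _; rewrite integral_gaussian_expR; congr (expR _)%:E.
  by rewrite -/(r s) exprMn u2; field.
rewrite -ge0_integral_sum//; last by move=> s; apply/measurable_EFinP; exact: mexp.
(* [3/8 = (1 - 2^-2) / 2] makes the last integral equal to [2]. *)
apply: (@le_trans _ _ (\int[normal_prob 0 1]_z (2 ^+ n * expR (3 / 8 * z ^+ 2))%:E)%E).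
  apply: ge0_le_integral => //.
  - by move=> z _; apply: sume_ge0 => s _; rewrite lee_fin expR_ge0.
  - by apply: emeasurable_sum => s; apply/measurable_EFinP; exact: mexp.
  - by apply/measurable_EFinP; apply: measurable_funM.
  move=> z _; rewrite sumEFin lee_fin.
  under eq_bigr => s _.
    rewrite (_ : u * r s * z = \sum_i (u * z * x i) * spin R s i); last first.
      rewrite /r mulrAC mulr_sumr; apply: eq_bigr => i _; exact: mulrA.
    over.
  rewrite sum_config_expR.
  apply: (@le_trans _ _ (\prod_(i < n) (2 * expR (2 * (u * z) ^+ 2)))).
    apply: ler_prod => i _; rewrite addr_ge0 ?expR_ge0//=.
    by have := expR_sum_le_square (u * z * x i); rewrite [(_ * x i) ^+ 2]exprMn x1 mulr1.
  rewrite prodr_const card_ord exprMn ler_wpM2l ?exprn_ge0//.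
  rewrite -expRM_natl ler_expR exprMn u2 -mulr_natr.
  have : 0 <= z ^+ 2 by exact: sqr_ge0.
  by move: thn th0; nra.
rewrite ge0_integral_mull ?exprn_ge0//.
rewrite (@integral_gaussian_square _ 2)//; last by field.
by rewrite -EFinM lee_fin mulrC.
Qed.

Definition pairs (n : nat) : {set 'I_n * 'I_n} := [set p : 'I_n * 'I_n | (p.1 < p.2)%N]%SET.

Lemma sum_pairs (R : realType) (n : nat) (F : 'I_n -> 'I_n -> R) :
  \sum_(i < n) \sum_(j < n | (i < j)%N) F i j = \sum_(p in pairs n) F p.1 p.2.
Proof. by rewrite pair_big_dep/=; apply: eq_bigl => p; rewrite inE. Qed.

(** Used with [x i] the product of two spins, to express the covariance of two
    energies by the overlap, and with [x i = 1], to count the pairs. *)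
Lemma sqr_sum_pairs (R : realType) (n : nat) (x : 'I_n -> R) :
  (\sum_i x i) ^+ 2 =
  \sum_i x i ^+ 2 + 2 * \sum_(p in pairs n) x p.1 * x p.2.
Proof.
rewrite expr2 big_distrlr/= -(sum_pairs (fun i j => x i * x j)).
rewrite mulr_natl mulr2n.
have -> : \sum_(i < n) \sum_(j < n) x i * x j =
    \sum_(i < n) (x i ^+ 2 + (\sum_(j < n | (i < j)%N) x i * x j +
                              \sum_(j < n | (j < i)%N) x i * x j)).
  apply: eq_bigr => i _; rewrite (bigD1 i)//= -expr2; congr (_ + _).
  rewrite (bigID (fun j : 'I_n => (i < j)%N))/=; congr (_ + _); apply: eq_bigl => j.
    by rewrite andbC -val_eqE; case: ltnP => //= ij; rewrite gtn_eqF.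
  by rewrite -leqNgt ltn_neqAle -val_eqE.
rewrite !big_split/=; congr (_ + (_ + _)).
rewrite (exchange_big_dep xpredT)//=; apply: eq_bigr => i _.
by apply: eq_bigr => j _; exact: mulrC.
Qed.

Lemma card_pairs (R : realType) (n : nat) :
  2 * #|pairs n|%:R = n%:R * (n%:R - 1) :> R.
Proof.
have := @sqr_sum_pairs R n (fun=> 1).
rewrite sumr_const card_ord.
under eq_bigr do rewrite expr1n.
under [X in _ + _ * X]eq_bigr do rewrite mulr1.
rewrite !sumr_const card_ord => H.
by rewrite mulrBr -expr2 H; ring.
Qed.

(** * Exponential moments, second moment method, convexity *)

Lemma expectation_expR_linear d (T : measurableType d) (R : realType)
    (P : probability T R) (I : finType) (D : {set I}) (X : I -> {RV P >-> R})
    (a : I -> R) :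
  mutually_independent D X -> (forall i, i \in D -> standard_gaussian (X i)) ->
  (\int[P]_w (expR (\sum_(i in D) a i * X i w))%:E =
   (expR (\sum_(i in D) a i ^+ 2 / 2))%:E)%E.
Proof.
move=> indep gX.
pose f i (x : R) := expR (a i * x).
have mf i : measurable_fun setT (f i).
  by apply: measurableT_comp => //; exact: measurable_funM.
have f0 i x : 0 <= f i x by exact: expR_ge0.
have fE i : i \in D -> (\int[P]_w (f i (X i w))%:E = (expR (a i ^+ 2 / 2))%:E)%E.
  move=> iD; rewrite (ge0_integral_standard_gaussian (gX i iD) (mf i) (f0 i)).
  exact: integral_gaussian_expR.
under eq_integral do rewrite expR_sum.
rewrite (expectation_prod indep mf f0); last by move=> i iD; rewrite fE// ltry.
by rewrite (eq_bigr _ fE) prodEFin expR_sum.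
Qed.

(** Paley-Zygmund inequality for the ratio [2].  Pointwise,
    [Z <= m/2 + 2 m 1_E + Z^2 / (8 m)] where [E] is the event in question; take
    expectations. *)
Lemma second_moment_method d (T : measurableType d) (R : realType)
    (P : probability T R) (Z : T -> R) (m : R) :
  measurable_fun setT Z -> (forall w, 0 <= Z w) -> 0 < m ->
  (\int[P]_w (Z w)%:E = m%:E)%E ->
  (\int[P]_w (Z w ^+ 2)%:E <= (2 * m ^+ 2)%:E)%E ->
  ((1 / 8)%:E <= P [set w | (m / 2 <= Z w)%R])%E.
Proof.
move=> mZ Z0 m0 EZ EZ2; set E := [set w | _].
have mE : measurable E.
  rewrite (_ : E = Z @^-1` `[m / 2, +oo[); last first.
    by apply/seteqP; split => w /=; rewrite in_itv/= andbT.
  by rewrite -[X in measurable X]setTI; exact: mZ.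
have mind : measurable_fun setT (\1_E : T -> R) by exact: measurable_indic.
have mZ2 : measurable_fun setT (fun w => Z w ^+ 2) by exact: measurable_funX.
have i2 : 0 <= (8 * m)^-1 by rewrite invr_ge0 mulr_ge0// ltW.
have q0 w : 0 <= (8 * m)^-1 * Z w ^+ 2 by rewrite mulr_ge0// sqr_ge0.
have mq : measurable_fun setT (fun w => (8 * m)^-1 * Z w ^+ 2) by exact: measurable_funM.
have e0 w : 0 <= 2 * m * \1_E w by rewrite mulr_ge0// mulr_ge0// ltW.
have me : measurable_fun setT (fun w => 2 * m * \1_E w) by exact: measurable_funM.
have m20 : 0 <= m / 2 by rewrite divr_ge0// ltW.
have H : (\int[P]_w (Z w)%:E <= \int[P]_w
    (m / 2 + (2 * m * \1_E w + (8 * m)^-1 * Z w ^+ 2))%:E)%E.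
  apply: ge0_le_integral_real => //.
    by apply: measurable_funD => //; exact: measurable_funD.
  move=> w; rewrite indicE.
  have [wE|wE] := boolP (w \in E); last first.
    rewrite mulr0 add0r (@le_trans _ _ (m / 2))//; last by rewrite lerDl.
    by rewrite ltW// ltNge; apply: contra wE => ?; exact: mem_set.
  (* On [E], [Z <= 2 m + Z^2 / (8 m)] with a square as slack. *)
  rewrite mulr1 -subr_ge0.
  rewrite (_ : _ - _ = m / 2 + (8 * m)^-1 * (Z w - 4 * m) ^+ 2).
    by apply: addr_ge0 => //; rewrite mulr_ge0// sqr_ge0.
  by field; rewrite gt_eqF.
move: H; rewrite ge0_integral_addr//; last 2 first.
- exact: measurable_funD.
- by move=> w; exact: addr_ge0.
have cst_m : (\int[P]__ (m / 2)%:E = (m / 2)%:E)%E.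
  by rewrite integral_cst; [rewrite /= probability_setT mule1|].
rewrite ge0_integral_addr// cst_m.
rewrite ge0_integral_mull//; last by rewrite mulr_ge0// ltW.
rewrite ge0_integral_mull//; last by move=> w; exact: sqr_ge0.
rewrite (_ : (\int[P]_w (\1_E w)%:E)%E = P E); last by rewrite integral_indic ?setIT.
rewrite EZ -(fineK (fin_num_measure P E mE)) => H.
have {}H : ((m)%:E <= (m / 2)%:E +
    ((2 * m)%:E * (fine (P E))%:E + ((8 * m)^-1)%:E * (2 * m ^+ 2)%:E))%E.
  apply: (le_trans H); apply: leeD => //; apply: leeD => //.
  by apply: lee_wpmul2l.
move: H; rewrite -!EFinM -!EFinD !lee_fin => H.
have e : (8 * m)^-1 * (2 * m ^+ 2) = m / 4 by field; rewrite gt_eqF.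
have : m * (1 / 8) <= m * fine (P E) by lra.
by rewrite ler_pM2l.
Qed.

(** Convexity of the exponential between [0] and [z], from its tangent line at
    [l z] evaluated at these two points. *)
Lemma expR_mull_le (R : realType) (l z : R) : 0 <= l -> l <= 1 ->
  expR (l * z) <= 1 - l + l * expR z.
Proof.
move=> l0 l1.
have h1 : expR (l * z) * (1 + (1 - l) * z) <= expR z.
  rewrite [z in leRHS](_ : z = l * z + (1 - l) * z); last by ring.
  by rewrite expRD ler_wpM2l ?expR_ge0// expR_ge1Dx.
have h2 : expR (l * z) * (1 - l * z) <= 1.
  rewrite -[leRHS](expRxMexpNx_1 (l * z)) ler_wpM2l ?expR_ge0//.
  exact: expR_ge1Dx.
have := lerD (ler_wpM2l l0 h1) (ler_wpM2l (_ : 0 <= 1 - l) h2).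
rewrite subr_ge0 => /(_ l1).
rewrite (_ : l * _ + _ = expR (l * z)); last by ring.
lra.
Qed.

(** With [M] the logarithm of the mean of [expR (x s)], averaging
    [expR_mull_le] at [z = x s - M] over [s] bounds the mean of
    [expR (l (x s - M))] by [1]. *)
Lemma log_sum_exp_convex (R : realType) (C : finType) (c0 : C) (l : R) (x : C -> R) :
  0 <= l -> l <= 1 ->
  ln (\sum_s expR (l * x s)) - ln #|C|%:R <=
  l * (ln (\sum_s expR (x s)) - ln #|C|%:R).
Proof.
move=> l0 l1.
have C0 : 0 < #|C|%:R :> R by rewrite ltr0n; apply/card_gt0P; exists c0.
have sum0 (y : C -> R) : 0 < \sum_s expR (y s).
  rewrite (bigD1 c0)//= ltr_pwDl ?expR_gt0// sumr_ge0// => s _; exact: expR_ge0.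
set M := (X in l * X).
have eM : expR (- M) * \sum_s expR (x s) = #|C|%:R.
  rewrite expRN expRB !lnK ?posrE// invf_div mulfVK// gt_eqF//.
have H : \sum_s expR (l * (x s - M)) <= #|C|%:R.
  apply: (@le_trans _ _ (\sum_s (1 - l + l * (expR (- M) * expR (x s))))).
    apply: ler_sum => s _; rewrite -expRD (addrC (- M)); exact: expR_mull_le.
  rewrite big_split/= sumr_const -mulr_sumr -mulr_sumr eM.
  by rewrite -[X in X + _]mulr_natr -mulrDl subrK mul1r.
rewrite lerBlDr -ler_expR expRD !lnK ?posrE//.
apply: le_trans (ler_wpM2l (expR_ge0 (l * M)) H).
rewrite mulr_sumr le_eqVlt; apply/orP; left; apply/eqP.
by apply: eq_bigr => s _; rewrite -expRD; congr expR; ring.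
Qed.

(** * Moments of the partition function *)

Definition pair_spin (R : realType) (n : nat) (s : config n) (p : 'I_n * 'I_n) : R :=
  spin R s p.1 * spin R s p.2.

(** The inverse temperature is absorbed in the energy, which is thus a linear
    form in the disorder [y] with explicit coefficients. *)
Definition energy (R : realType) (n : nat) (b : R) (y : 'I_n * 'I_n -> R)
    (s : config n) : R :=
  \sum_(p in pairs n) (b / Num.sqrt n%:R * pair_spin R s p) * y p.

Definition partition_function (R : realType) (n : nat) (b : R)
  (y : 'I_n * 'I_n -> R) : R := \sum_(s : config n) expR (energy b y s).

Lemma sk_hamiltonianE (R : realType) (n : nat) (b : R) (g : 'I_n -> 'I_n -> R)
    (s : config n) :
  b * sk_hamiltonian g 0 s = energy b (fun p => g p.1 p.2) s.
Proof.
rewrite /sk_hamiltonian mul0r addr0 (sum_pairs (fun i j => g i j * spin R s i * spin R s j)).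
rewrite mulrA mulr_sumr; apply: eq_bigr => p _; rewrite /pair_spin; ring.
Qed.

Lemma sk_free_energyE (R : realType) (n : nat) (b : R) (g : 'I_n -> 'I_n -> R) :
  sk_free_energy b 0 g = ln (partition_function b (fun p => g p.1 p.2)).
Proof. by congr ln; apply: eq_bigr => s _; rewrite sk_hamiltonianE. Qed.

Lemma partition_function_gt0 (R : realType) (n : nat) (b : R) (y : 'I_n * 'I_n -> R) :
  0 < partition_function b y.
Proof.
rewrite /partition_function (bigD1 [ffun=> false])//=.
by rewrite ltr_pwDl ?expR_gt0// sumr_ge0// => s _; exact: expR_ge0.
Qed.

Lemma energy_scale_coupling (R : realType) (n : nat) (b l : R) (y : 'I_n * 'I_n -> R)
  (s : config n) : energy b (fun p => l * y p) s = l * energy b y s.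
Proof. by rewrite /energy mulr_sumr; apply: eq_bigr => p _; rewrite mulrCA. Qed.

Lemma energy_scale_temperature (R : realType) (n : nat) (b l : R) (y : 'I_n * 'I_n -> R)
  (s : config n) : energy (l * b) y s = l * energy b y s.
Proof. by rewrite /energy mulr_sumr; apply: eq_bigr => p _; rewrite -!mulrA. Qed.

Lemma spin_sqr (R : realType) (n : nat) (s : config n) (i : 'I_n) : spin R s i ^+ 2 = 1.
Proof. by rewrite /spin; case: (s i); rewrite ?expr0 ?expr1 ?sqrrN expr1n. Qed.

Lemma pair_spin_sqr (R : realType) (n : nat) (s : config n) (p : 'I_n * 'I_n) :
  pair_spin R s p ^+ 2 = 1.
Proof. by rewrite exprMn !spin_sqr mulr1. Qed.

Definition mean_partition (R : realType) (n : nat) (b : R) : R :=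
  2 ^+ n * expR (b ^+ 2 / n%:R * #|pairs n|%:R / 2).

Section moments.
Context d (T : measurableType d) (R : realType) (P : probability T R) (n : nat)
  (X : 'I_n * 'I_n -> {RV P >-> R}).
Hypothesis n0 : (0 < n)%N.
Hypothesis indep : mutually_independent (pairs n) X.
Hypothesis gX : forall p, p \in pairs n -> standard_gaussian (X p).

Lemma measurable_energy (b : R) (s : config n) :
  measurable_fun setT (fun w => energy b (fun p => X p w) s).
Proof.
rewrite /energy; under eq_fun do rewrite -big_filter.
by apply: measurable_sum => p; exact: measurable_funM.
Qed.

Let nR : 0 < n%:R :> R. Proof. by rewrite ltr0n. Qed.

Let sqrt_n : Num.sqrt (n%:R : R) ^+ 2 = n%:R.
Proof. by rewrite sqr_sqrtr// ltW. Qed.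

Lemma expectation_partition (b : R) :
  (\int[P]_w (partition_function b (fun p => X p w))%:E = (mean_partition n b)%:E)%E.
Proof.
under eq_integral do rewrite /partition_function -sumEFin.
rewrite ge0_integral_sum//; last first.
  move=> s; apply/measurable_EFinP; apply: measurableT_comp => //.
  exact: measurable_energy.
under eq_bigr do rewrite (expectation_expR_linear _ indep gX).
rewrite sumEFin /mean_partition; congr EFin.
rewrite (eq_bigr (fun=> expR (b ^+ 2 / n%:R * #|pairs n|%:R / 2))).
  by rewrite sumr_const card_config -[LHS]mulr_natl natrX.
move=> s _; congr expR.
rewrite (eq_bigr (fun=> b ^+ 2 / n%:R / 2)).
  by rewrite sumr_const -mulr_natl; field; rewrite gt_eqF.
by move=> p _; rewrite exprMn pair_spin_sqr mulr1 exprMn exprVn sqrt_n.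
Qed.

(** The variance of the sum of the energies of two configurations depends only
    on their overlap. *)
Lemma pair_overlap (s t : config n) :
  \sum_(p in pairs n) (pair_spin R s p + pair_spin R t p) ^+ 2 =
  2 * #|pairs n|%:R + ((\sum_i spin R s i * spin R t i) ^+ 2 - n%:R).
Proof.
rewrite sqr_sum_pairs.
rewrite [\sum_i _](eq_bigr (fun=> 1)); last first.
  by move=> i _; rewrite exprMn !spin_sqr mulr1.
rewrite sumr_const card_ord [_%:R + _]addrC addrK.
rewrite (eq_bigr (fun p => 2 + 2 * (spin R s p.1 * spin R t p.1 *
    (spin R s p.2 * spin R t p.2)))); last first.
  move=> p _; rewrite sqrrD !pair_spin_sqr /pair_spin; ring.
by rewrite big_split/= sumr_const -mulr_sumr -[X in X + _ = _]mulr_natr.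
Qed.

(** Expanding the square gives a sum over two replicas of Gaussian exponential
    moments.  Relative to the squared mean each term carries
    [expR (b^2 / (2 n) r^2)], with [r] the overlap, up to a factor at most [1];
    [sum_config_square] sums these over the second replica. *)
Lemma expectation_partition_sqr_le (b : R) : b ^+ 2 <= 3 / 16 ->
  (\int[P]_w (partition_function b (fun p => X p w) ^+ 2)%:E <=
   (2 * mean_partition n b ^+ 2)%:E)%E.
Proof.
move=> b3.
under eq_integral => w _.
  rewrite expr2 /partition_function big_distrlr/= -sumEFin.
  under eq_bigr => s _.
    rewrite -sumEFin.
    under eq_bigr => t _.
      rewrite -expRD /energy -big_split/=.
      under eq_bigr do rewrite -mulrDl -mulrDr.
      over.
    over.
  over.
have me s t : measurable_fun setT (fun w => (expR (\sum_(p in pairs n)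
    b / Num.sqrt n%:R * (pair_spin R s p + pair_spin R t p) * X p w))%:E).
  apply/measurable_EFinP; apply: measurableT_comp => //.
  under eq_fun do rewrite -big_filter.
  by apply: measurable_sum => p; exact: measurable_funM.
rewrite ge0_integral_sum//; last 2 first.
- by move=> s; apply: emeasurable_sum => t; exact: me.
- by move=> s w _; apply: sume_ge0 => t _; rewrite lee_fin expR_ge0.
under eq_bigr => s _.
  rewrite ge0_integral_sum//.
  under eq_bigr do rewrite (expectation_expR_linear _ indep gX).
  rewrite sumEFin.
  over.
rewrite sumEFin lee_fin.
set M : R := #|pairs n|%:R.
apply: (@le_trans _ _ (\sum_(s : config n) expR (b ^+ 2 / n%:R * M) * (2 * 2 ^+ n))).
  apply: ler_sum => s _.
  apply: (@le_trans _ _ (\sum_(t : config n) expR (b ^+ 2 / n%:R * M) *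
      expR (b ^+ 2 / (2 * n%:R) * (\sum_i spin R s i * spin R t i) ^+ 2))).
    apply: ler_sum => t _; rewrite -expRD ler_expR.
    rewrite (eq_bigr (fun p => b ^+ 2 / (2 * n%:R) *
      (pair_spin R s p + pair_spin R t p) ^+ 2)); last first.
      move=> p _; rewrite exprMn exprMn exprVn sqrt_n; field; rewrite gt_eqF//.
    rewrite -mulr_sumr pair_overlap -/M mulrDr mulrBr.
    have -> : b ^+ 2 / (2 * n%:R) * (2 * M) = b ^+ 2 / n%:R * M.
      by field; rewrite gt_eqF.
    rewrite lerD2l gerBl; apply: mulr_ge0; last exact: ltW.
    by rewrite divr_ge0 ?sqr_ge0// mulr_ge0// ltW.
  rewrite -mulr_sumr ler_wpM2l ?expR_ge0//.
  apply: sum_config_square; first by move=> i; exact: spin_sqr.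
    by rewrite divr_ge0 ?sqr_ge0// mulr_ge0// ltW.
  rewrite (_ : _ * n%:R = b ^+ 2 / 2); first lra.
  by field; rewrite gt_eqF.
rewrite sumr_const card_config -[leLHS]mulr_natr natrX /mean_partition.
rewrite exprMn -expRM_natl -/M.
have -> : 2 * (b ^+ 2 / n%:R * M / 2) = b ^+ 2 / n%:R * M by field; rewrite gt_eqF.
by rewrite le_eqVlt; apply/orP; left; apply/eqP; ring.
Qed.

End moments.

(** * Excess free energy and anticoncentration *)

(** Subtracting the value at infinite temperature makes the scaling
    inequalities below homogeneous. *)
Definition excess_free_energy (R : realType) (n : nat) (b : R)
  (y : 'I_n * 'I_n -> R) : R := ln (partition_function b y) - ln #|config n|%:R.

Lemma excess_scale_coupling (R : realType) (n : nat) (b l : R)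
    (y : 'I_n * 'I_n -> R) : 0 <= l -> l <= 1 ->
  excess_free_energy b (fun p => l * y p) <= l * excess_free_energy b y.
Proof.
move=> l0 l1; have := @log_sum_exp_convex R (config n) [ffun=> false] l (energy b y) l0 l1.
by under eq_bigr do rewrite -energy_scale_coupling.
Qed.

Lemma excess_scale_temperature (R : realType) (n : nat) (b l : R)
    (y : 'I_n * 'I_n -> R) : 0 <= l -> l <= 1 ->
  excess_free_energy (l * b) y <= l * excess_free_energy b y.
Proof.
move=> l0 l1; have := @log_sum_exp_convex R (config n) [ffun=> false] l (energy b y) l0 l1.
by under eq_bigr do rewrite -energy_scale_temperature.
Qed.

(** The lower bound at [b0] comes from the partition function; convexity then
    says that the excess at [b] is at least [b / b0] times that at [b0]. *)
Lemma excess_lower_bound (R : realType) (n : nat) (b0 b D : R)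
    (y : 'I_n * 'I_n -> R) :
  0 < b0 -> b0 <= b -> 0 < D ->
  D <= b0 ^+ 2 / n%:R * #|pairs n|%:R / 2 - ln 2 ->
  mean_partition n b0 / 2 <= partition_function b0 y ->
  D <= excess_free_energy b y.
Proof.
move=> b00 b0b D0 DM Zb.
have bp : 0 < b by exact: lt_le_trans b0b.
have h0 : D <= excess_free_energy b0 y.
  apply: (le_trans DM); rewrite /excess_free_energy lerBrDr.
  rewrite -ler_expR !expRD expRN !lnK ?posrE//; last 2 first.
  - exact: partition_function_gt0.
  - by rewrite card_config ltr0n expn_gt0.
  apply: le_trans Zb; rewrite card_config natrX /mean_partition.
  by rewrite mulrC mulrA.
have := @excess_scale_temperature R n b (b0 / b) y.
rewrite divfK ?gt_eqF// => /(_ (divr_ge0 (ltW b00) (ltW bp))).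
rewrite ler_pdivrMr// mul1r => /(_ b0b) h1.
have h2 : D <= b0 / b * excess_free_energy b y by exact: le_trans h1.
have e0 : 0 < excess_free_energy b y.
  by rewrite -(pmulr_rgt0 _ (divr_gt0 b00 bp)); exact: lt_le_trans h2.
apply: (le_trans h2); rewrite -[leRHS]mul1r ler_pM2r//.
by rewrite ler_pdivrMr// mul1r.
Qed.

(** The choice [s^-2 = 1 + x], to be used with [x = 1/n]: the dilation moves
    [s] away from [1] at first order in [x], whereas the second moment
    [s^-2 t] of the likelihood ratio differs from [1] only at second order, so
    that its power with about [n^2/2] factors stays bounded. *)
Lemma contraction_factor (R : realType) (x : R) : 0 < x -> x <= 1 ->
  exists s t : R, [/\ [/\ 0 < s, 0 < t & s <= 1 - x / 4],
    t ^- 2 = 2 * s ^- 2 - 1 & s ^- 2 * t <= expR (x ^+ 2 / 2)].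
Proof.
move=> x0 x1.
have sx : 0 < Num.sqrt (1 + x) by rewrite sqrtr_gt0; lra.
have tx : 0 < Num.sqrt (1 + 2 * x) by rewrite sqrtr_gt0; lra.
have sx2 : Num.sqrt (1 + x) ^+ 2 = 1 + x by rewrite sqr_sqrtr//; lra.
have tx2 : Num.sqrt (1 + 2 * x) ^+ 2 = 1 + 2 * x by rewrite sqr_sqrtr//; lra.
exists (Num.sqrt (1 + x))^-1, (Num.sqrt (1 + 2 * x))^-1.
rewrite !exprVn !invrK sx2 tx2; split; last 2 first.
- by ring.
- have p2 : (expR (x ^+ 2 / 2)) ^+ 2 = expR (x ^+ 2).
    by rewrite -expRM_natl; congr expR; field.
  have q0 : 0 <= (1 + x) / Num.sqrt (1 + 2 * x) by rewrite divr_ge0 ?(ltW tx)//; lra.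
  rewrite -(@ler_pXn2r _ 2)// ?nnegrE ?expR_ge0//.
  rewrite p2 expr_div_n tx2 ler_pdivrMr; last lra.
  have := expR_ge1Dx (x ^+ 2); have := sqr_ge0 x; nra.
split; rewrite ?invr_gt0//.
rewrite -(@ler_pXn2r _ 2)// ?nnegrE ?invr_ge0 ?(ltW sx)//; last lra.
rewrite exprVn sx2 -div1r ler_pdivrMr; last lra.
by nra.
Qed.

Section anticoncentration.
Context d (T : measurableType d) (R : realType) (P : probability T R) (n : nat)
  (X : 'I_n * 'I_n -> {RV P >-> R}).
Hypothesis indep : mutually_independent (pairs n) X.
Hypothesis gX : forall p, p \in pairs n -> standard_gaussian (X p).

Lemma measurable_log_partition (b : R) : measurable_fun setT
  ((fun y => ln (partition_function b y)) : disorder R (pairs n) -> R).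
Proof.
apply: measurableT_comp; first exact: measurable_ln.
apply: measurable_sum => s; apply: measurableT_comp => //.
have -> : (fun y : disorder R (pairs n) => energy b y s) = (fun y => \sum_p
    if p \in pairs n then b / Num.sqrt n%:R * pair_spin R s p * y p else 0).
  by apply/funext => y; rewrite /energy big_mkcond.
apply: measurable_sum => p; have [pD|//] := boolP (p \in pairs n).
by apply: measurable_funM => //; exact: measurable_coordinate.
Qed.

(** Let [E] be the event of a large partition function at [b0], of probability
    at least [1/8].  On [E] the free energies of the original and of the dilated
    disorder are at distance at least [b0^2 / 64], so one of them leaves
    [[a, c]].  If [q] is the probability that the first does, the comparison of
    laws with [K = 8] bounds the probability that the second does by
    [8 q + 1/16].  Hence [1/8 <= 9 q + 1/16]. *)
Lemma log_partition_anticoncentration (b0 b : R) :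
  0 < b0 -> b0 <= 1 / 4 -> b0 <= b -> (2 <= n)%N -> 16 <= b0 ^+ 2 * n%:R ->
  forall a c : R, c - a <= b0 ^+ 2 / 128 ->
  (P [set w | (a <= ln (partition_function b (fun p => X p w)) <= c)%R] <=
   (1 - 1 / 144)%:E)%E.
Proof.
move=> b00 b04 b0b n2 bn a c ca.
have n0 : (0 < n)%N by exact: leq_trans n2.
have nR : 2 <= n%:R :> R by rewrite (ler_nat _ 2).
have cM := card_pairs R n.
set M : R := #|pairs n|%:R in cM.
have M0 : 0 <= M by rewrite ler0n.
have [s [t [[s0 t0 sx] st sb]]] : exists s t : R, [/\ [/\ 0 < s, 0 < t &
    s <= 1 - n%:R^-1 / 4], t ^- 2 = 2 * s ^- 2 - 1 &
    s ^- 2 * t <= expR (n%:R^-1 ^+ 2 / 2)].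
  by apply: contraction_factor; rewrite ?invr_gt0 ?invf_le1//; lra.
have s1 : s <= 1.
  by apply: (le_trans sx); rewrite gerBl divr_ge0// invr_ge0; lra.
pose F (y : 'I_n * 'I_n -> R) : R := ln (partition_function b y).
pose B : set (disorder R (pairs n)) := F @^-1` (~` `[a, c]).
have mB : measurable B.
  rewrite -[X in measurable X]setTI; apply: measurable_log_partition => //.
  exact: measurableC.
pose E := [set w | mean_partition n b0 / 2 <= partition_function b0 (fun p => X p w)].
have mZ : measurable_fun setT (fun w => partition_function b0 (fun p => X p w)).
  apply: measurable_sum => u; apply: measurableT_comp => //.
  exact: measurable_energy.
have PE : ((1 / 8)%:E <= P E)%E.
  apply: second_moment_method.
  - exact: mZ.
  - by move=> w; exact/ltW/partition_function_gt0.
  - by rewrite mulr_gt0 ?exprn_gt0 ?expR_gt0.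
  - exact: expectation_partition.
  - by apply: expectation_partition_sqr_le => //; nra.
have PB' := scaled_gaussian_le indep gX s0 t0 st (ltr0n _ 8) mB.
(* The exponent of the mean is [b0^2 (n - 1) / 4]; giving up most of it
   absorbs the loss of [ln 2]. *)
pose D := b0 ^+ 2 * n%:R / 16.
have D0 : 0 < D by rewrite /D divr_gt0// mulr_gt0// ?exprn_gt0//; lra.
have EB : E `<=` [set w | B (fun p => X p w)] `|` [set w | B (fun p => s * X p w)%R].
  move=> w Ew; apply: contrapT => /not_orP[/= /contrapT Ba /contrapT Bs].
  move: Ba Bs; rewrite /F/= !in_itv/= => /andP[_ Fc] /andP[Fa _].
  have := @excess_lower_bound R n b0 b D (fun p => X p w) b00 b0b D0 _ Ew.
  have De : D <= b0 ^+ 2 / n%:R * #|pairs n|%:R / 2 - ln 2.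
    have -> : b0 ^+ 2 / n%:R * #|pairs n|%:R / 2 = b0 ^+ 2 * (n%:R - 1) / 4.
      rewrite -/M; have -> : M = n%:R * (n%:R - 1) / 2 by rewrite -cM; field.
      by field; lra.
    have := @le_ln1Dx R 1 ltac:(lra).
    rewrite /D; have := sqr_ge0 b0; nra.
  move=> /(_ De) ex.
  have := @excess_scale_coupling R n b s (fun p => X p w) (ltW s0) s1.
  move: ex; rewrite /excess_free_energy.
  set f1 := ln _ in Fc *. set f2 := ln (partition_function b (fun p => s * X p w)) in Fa *.
  set L := ln _ => ex sc.
  have nV : 0 < n%:R^-1 :> R by rewrite invr_gt0; lra.
  have gap : (n%:R^-1 / 4) * D <= (1 - s) * (f1 - L).
    by apply: ler_pM => //; [exact: (ltW D0)|lra].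
  have gapE : (n%:R^-1 / 4) * D = b0 ^+ 2 / 64 by rewrite /D; field; lra.
  have : 0 < b0 ^+ 2 by rewrite exprn_gt0.
  nra.
have mY (Y : 'I_n * 'I_n -> T -> R) : (forall p, measurable_fun setT (Y p)) ->
    measurable [set w | B (fun p => Y p w)].
  move=> mY; rewrite -[X in measurable X]setTI.
  exact: (measurable_fun_disorder mY measurableT mB).
have mB1 := mY (fun p => X p) (fun p => measurable_funPT (X p)).
have mB2 : measurable [set w | B (fun p => s * X p w)%R].
  by apply: (mY (fun p w => s * X p w)) => p; exact: measurable_funM.
have mE : measurable E.
  rewrite (_ : E = (fun w => partition_function b0 (fun p => X p w)) @^-1`
    `[mean_partition n b0 / 2, +oo[); last first.
    by rewrite /E; apply/seteqP; split => w /=; rewrite in_itv/= andbT.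
  by rewrite -[X in measurable X]setTI; exact: mZ.
(* Fewer than [n^2 / 2] factors, each at most [expR (n^-2 / 2)]. *)
have sM : (s ^- 2 * t) ^+ #|pairs n| <= 2.
  have x0 : 0 <= s ^- 2 * t by rewrite mulr_ge0 ?(ltW t0)// invr_ge0 sqr_ge0.
  apply: (le_trans (lerXn2r _ _ _ sb)); rewrite ?nnegrE ?expR_ge0//.
  rewrite -expRM_natr -/M.
  apply: (@le_trans _ _ (expR (1 / 4))).
    rewrite ler_expR (_ : _ * M = (1 - n%:R^-1) / 4).
      have : 0 < n%:R^-1 :> R by rewrite invr_gt0; lra.
      lra.
    by have -> : M = n%:R * (n%:R - 1) / 2; [rewrite -cM; field|field; lra].
  have := expR_ge1Dx (- (1 / 4) : R); rewrite expRN => h.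
  have e0 := expR_gt0 (1 / 4 : R).
  have : (1 + - (1 / 4)) * expR (1 / 4) <= 1 :> R.
    by rewrite -ler_pdivlMr// [leRHS]div1r.
  lra.
have PC : P [set w | (a <= ln (partition_function b (fun p => X p w)) <= c)%R] =
    (1 - P [set w | B (fun p => X p w)])%E.
  rewrite -probability_setC//; congr (P _); apply/seteqP; split => w /=.
    by move=> ac; rewrite /B /F/= in_itv/= => /(_ ac).
  by rewrite /B /F/= => /contrapT; rewrite /= in_itv.
rewrite PC.
have fin1 := fin_num_measure P _ mB1.
have : (P E <= P [set w | B (fun p => X p w)] + P [set w | B (fun p => s * X p w)%R])%E.
  apply: le_trans (measureU2 _ mB1 mB2).
  by apply: le_measure => //; rewrite inE//; exact: measurableU.
move=> /(le_trans PE)/le_trans => /(_ _ (leeD2l _ PB')).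
rewrite -(fineK fin1) -EFinM -!EFinD !lee_fin.
move: (fine _) => q; lra.
Qed.

End anticoncentration.

Theorem theorem2p4 (R : realType) (d : nat -> measure_display)
    (T : forall n : nat, measurableType (d n))
    (P : forall n : nat, probability (T n) R)
    (g : forall n : nat, 'I_n -> 'I_n -> {RV (P n) >-> R})
    (beta : R) (hbeta : 0 < beta)
    (hg : forall n : nat, (0 < n)%N -> iid_gaussian_couplings (g n)) :
  fluctuations_at_least (fun n => free_energy_RV beta 0 (g n)) (fun=> 1).
Proof.
(* A small inverse temperature, where the second moment method works. *)
pose b0 := Num.min beta (1 / 4).
have b00 : 0 < b0 by rewrite lt_min hbeta; lra.
have b04 : b0 <= 1 / 4 by rewrite ge_min lexx orbT.
have b0b : b0 <= beta by rewrite ge_min lexx.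
have b2 : 0 < b0 ^+ 2 by rewrite exprn_gt0.
exists (b0 ^+ 2 / 128), (1 / 144); split; [by rewrite divr_gt0|lra|].
near=> n => a c ac; rewrite mulr1 => ca.
have n2 : (2 <= n)%N by near: n; exists 2%N.
(* From here on [n] is so large that [ln 2 <= 1 <= b0^2 n / 16]. *)
have bn : 16 <= b0 ^+ 2 * n%:R.
  rewrite mulrC -ler_pdivrMr//.
  near: n; exact: nbhs_infty_ger.
have n0 : (0 < n)%N by exact: leq_trans n2.
have [gX indep] := hg n n0.
have := @log_partition_anticoncentration _ _ _ (P n) n (fun p => g n p.1 p.2)
  indep _ b0 beta b00 b04 b0b n2 bn a c ca.
have gX' p : p \in pairs n -> standard_gaussian (g n p.1 p.2).
  by rewrite inE => /gX.
move=> /(_ gX').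
rewrite (_ : (fun w => _) = [set x | a <= free_energy_RV beta 0 (g n) x <= c]%classic)//.
by apply/funext => x; rewrite /= /free_energy sk_free_energyE.
Unshelve. all: by end_near.
Qed.
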